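(* Let $G$ be a countable directed union of groups $G_i$. Let $\mathfrak F$ be a family of subgroups of $G$ such that each $H\in\mathfrak F$ is a subgroup of some $G_j$. Then $$cd_{\mathfrak F}(G)\le 1+\max_i\{cd_{\mathfrak F\cap G_i}(G_i)\}.$$
   Context: A family of subgroups $\mathfrak F$ of $G$ is a collection of subgroups closed under conjugation by elements of $G$ and under taking subgroups; for $S\le G$, $\mathfrak F\cap S=\{H\cap S\mid H\in\mathfrak F\}$. The orbit category $\mathcal O_{\mathfrak F}G$ has objects $G/H$, $H\in\mathfrak F$, and morphisms the $G$-maps; right $\mathcal O_{\mathfrak F}G$-modules are contravariant functors to abelian groups, with exactness objectwise. $cd_{\mathfrak F}(G)$ is the projective dimension of the constant module $\underline{\mathbb Z}$, i.e. the largest $n$ (possibly $\infty$) with $\mathrm{H}^n_{\mathfrak F}(G,-)=\mathrm{Ext}^n_{\mathfrak F}(\underline{\mathbb Z},-)\ne0$. ''Countable directed union'' means that the $G_i$ form a countable family of subgroups of $G$, directed under inclusion, with union $G$. The maximum is understood as $\infty$ if the values are unbounded. *)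

(* Defs.v *)
From HB Require Import structures.
From mathcomp Require Import all_boot all_order all_algebra.
From mathcomp Require Import all_classical all_reals.
From mathcomp Require Import ereal.

Set Implicit Arguments.
Unset Strict Implicit.
Unset Printing Implicit Defensive.

Import Order.TTheory GRing.Theory Num.Theory.

Local Open Scope classical_set_scope.
Local Open Scope group_scope.

Record category := Category {
  ob : Type;
  hom : ob -> ob -> Type;
  idmor : forall x, hom x x;
  compmor : forall x y z, hom y z -> hom x y -> hom x z;
  compmor1 : forall x y (f : hom x y), compmor f (idmor x) = f;
  comp1mor : forall x y (f : hom x y), compmor (idmor y) f = f;
  compmorA : forall x y z t (h : hom z t) (g : hom y z) (f : hom x y),
    compmor h (compmor g f) = compmor (compmor h g) f }.

Arguments idmor {c} x.

(* Contravariant functors from C to abelian groups. *)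
Record rmodule (C : category) := RModule {
  rmod :> ob C -> zmodType;
  res : forall x y, hom x y -> {additive rmod y -> rmod x};
  res_id : forall x m, res (idmor x) m = m;
  res_comp : forall x y z (g : hom y z) (f : hom x y) m,
    res (compmor g f) m = res f (res g m) }.

Record rmodhom (C : category) (M N : rmodule C) := RModHom {
  rmodhom_at :> forall x, {additive M x -> N x};
  rmodhom_nat : forall x y (f : hom x y) (m : M y),
    rmodhom_at x (res M f m) = res N f (rmodhom_at y m) }.

Section Modules.
Variable C : category.
Implicit Types L M N P : rmodule C.

Definition epi M N (f : rmodhom M N) := forall x, range (f x) = [set: N x].

Definition exact_at L M N (f : rmodhom L M) (g : rmodhom M N) :=
  forall x, range (f x) = [set m : M x | g x m = 0%R].

Definition is_zero M := forall x (m : M x), m = 0%R.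

Definition projective P :=
  forall M N (e : rmodhom M N) (f : rmodhom P N), epi e ->
  exists g : rmodhom P M, forall x (p : P x), e x (g x p) = f x p.

Definition proj_resolution_of_length M (n : nat) :=
  exists (P : nat -> rmodule C) (d : forall k, rmodhom (P k.+1) (P k))
         (eps : rmodhom (P 0%N) M),
    [/\ forall k, projective (P k),
        epi eps,
        exact_at (d 0%N) eps,
        forall k, exact_at (d k.+1) (d k)
      & forall k, (n < k)%N -> is_zero (P k)].

(* An infimum of natural numbers; it is +oo when no finite projective
   resolution exists. *)
Definition projdim (R : realType) M : \bar R :=
  ereal_inf [set (n%:R)%:E | n in proj_resolution_of_length M].

Definition constZ : rmodule C :=
  @RModule C (fun=> int) (fun _ _ _ => idfun)
    (fun _ _ => erefl) (fun _ _ _ _ _ _ => erefl).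

End Modules.

Section Subgroups.
Variable G : groupType.

Definition is_subgroup (H : set G) := group_closed [in H].

Record is_family (F : set (set G)) : Prop := IsFamily {
  family_subgroup : forall H, F H -> is_subgroup H;
  family_conj : forall H g, F H -> F [set h ^ g | h in H];
  family_sub : forall H K, F H -> is_subgroup K -> K `<=` H -> F K }.

End Subgroups.

Lemma groupClosed_closed (G : groupType) (S : groupClosed G) : group_closed [in S].
Proof. by split=> [|x y xS yS]; [exact: gpred1 | exact: gpredF]. Qed.

(* A subgroup regarded as a group in its own right. *)
Record subgroup_sort (G : groupType) (S : groupClosed G) :=
  SubgroupElt { sgval : G; sgvalP : sgval \in S }.

HB.instance Definition _ (G : groupType) (S : groupClosed G) :=
  [isSub for @sgval G S].
HB.instance Definition _ (G : groupType) (S : groupClosed G) :=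
  [Choice of subgroup_sort S by <:].
HB.instance Definition _ (G : groupType) (S : groupClosed G) :=
  SubChoice_isSubGroup.Build G [in S] (subgroup_sort S) (groupClosed_closed S).

(* The family of the H :&: S, for H in F, as subsets of the group S. *)
Definition family_cap (G : groupType) (F : set (set G)) (S : groupClosed G) :
    set (set (subgroup_sort S)) :=
  [set @sgval G S @^-1` H | H in F].

Arguments family_cap {G} F S.

Section OrbitCategory.
Variable G : groupType.
Implicit Types (H K L : set G) (g : G).

Definition ltrans g (A : set G) : set G := [set g * a | a in A].

(* The G-set G/H of left cosets of H. *)
Definition lcosets H := {A : set G | exists g, A = ltrans g H}.

Lemma ltransM g1 g2 A : ltrans g1 (ltrans g2 A) = ltrans (g1 * g2) A.
Proof.
rewrite /ltrans image_comp; apply: eq_imagel => a _ /=.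
by rewrite mulgA.
Qed.

Lemma lcosets_act_subproof H g (A : lcosets H) :
  exists g', ltrans g (sval A) = ltrans g' H.
Proof. by case: A => A [g' AE] /=; rewrite AE; exists (g * g'); rewrite ltransM. Qed.

Definition lcosets_act H g (A : lcosets H) : lcosets H :=
  exist _ (ltrans g (sval A)) (lcosets_act_subproof g A).

Record Gmap H K := MkGmap {
  Gmap_fun :> lcosets H -> lcosets K;
  Gmap_equiv : forall g A, Gmap_fun (lcosets_act g A) = lcosets_act g (Gmap_fun A) }.

Lemma Gmap_eq H K (f1 f2 : Gmap H K) : f1 =1 f2 -> f1 = f2.
Proof.
case: f1 f2 => [f1 e1] [f2 e2] /= /funext f12.
by case: f2 / f12 e2 => e2; rewrite (Prop_irrelevance e1 e2).
Qed.

Definition Gmap_id H : Gmap H H := @MkGmap H H id (fun _ _ => erefl).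

Lemma Gmap_comp_subproof H K L (f2 : Gmap K L) (f1 : Gmap H K) g A :
  f2 (f1 (lcosets_act g A)) = lcosets_act g (f2 (f1 A)).
Proof. by rewrite !Gmap_equiv. Qed.

Definition Gmap_comp H K L (f2 : Gmap K L) (f1 : Gmap H K) : Gmap H L :=
  MkGmap (Gmap_comp_subproof f2 f1).

(* Objects are indexed by the H in F, H standing for G/H. *)
Definition orbit_category (F : set (set G)) : category.
Proof.
refine (@Category {H : set G | F H} (fun x y => Gmap (sval x) (sval y))
  (fun x => Gmap_id (sval x))
  (fun x y z => @Gmap_comp (sval x) (sval y) (sval z)) _ _ _).
- by move=> x y f; apply: Gmap_eq.
- by move=> x y f; apply: Gmap_eq.
- by move=> x y z t h g f; apply: Gmap_eq.
Defined.

Definition cd (R : realType) (F : set (set G)) : \bar R :=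
  projdim R (constZ (orbit_category F)).

End OrbitCategory.

(* Main.v *)
From HB Require Import structures.
Require Import Defs.
From mathcomp Require Import all_boot all_order all_algebra.
From mathcomp Require Import all_classical all_reals.
From mathcomp Require Import ereal.

(** Write [n] for the maximum of the dimensions of the [G_i], and suppose that it
is finite. A countable directed family has a cofinal increasing sequence
[S_0 <= S_1 <= ...] ([cofinal_chain]). For every [k] there is the induction
functor [ind_k] from modules over the orbit category of [S_k] to modules over
that of [G]. The maps [G/S_k -> G/S_(k + 1)] give the mapping telescope

  [0 -> (+)_k ind_k Z -> (+)_k ind_k Z -> Z -> 0],

where the first map is [1 - shift] and the second one is the augmentation.

The value of [ind_k Z] at [G/L] is the free abelian group on the points of
[G/S_k] fixed by [L]. Since [L] lies in some [S_k], there are such points for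
large [k], and since [G] is the union of the [S_k], any two of them have a common
image in some [G/S_m]; hence the augmentation is the cokernel of [1 - shift].
The map [1 - shift] is injective because [shift] raises the levels. This is
[telescope_resolution], applied in [proj_resolution_chain].

It remains to see that the middle terms have projective resolutions of length
[n], for then the mapping cone of a chain map lifting [1 - shift] is a projective
resolution of [Z] of length [n + 1] ([proj_resolution_coker]). Induction is a
left Kan extension along the functor [S_k/H |-> G/H]. A [G]-map [G/L -> G/H] with
[H] in [S_k] determines a point [g S_k] of [G/S_k] fixed by [L], and it factors
uniquely through [G/L -> G/(L ^ g)] followed by the image of an [S_k]-map
([orbit_multiadjoint]). Therefore the module induced from [M] is at [G/L] the
direct sum, over the fixed points [g S_k], of the groups [M (S_k/(L ^ g))].
Hence induction is exact; it preserves projectives, being left adjoint to an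
exact functor ([proj_resolution_ind]). The sum over [k] is built into the
induction, by inducing along all the functors at once. *)

Set Implicit Arguments.
Unset Strict Implicit.
Unset Printing Implicit Defensive.

Import Order.TTheory GRing.Theory Num.Theory.

Local Open Scope classical_set_scope.
Local Open Scope ring_scope.

(* [hom] also names the space of linear maps between vector spaces. *)
Local Notation hom := Defs.hom.

(** * Images and lifting *)

Definition mk_additive (U V : zmodType) (f : U -> V) (fB : zmod_morphism f) :
    {additive U -> V} :=
  HB.pack f (GRing.isZmodMorphism.Build U V f fB).

Definition mk_rmodule (C : category) (M : ob C -> zmodType)
    (r : forall x y, hom x y -> M y -> M x)
    (rB : forall x y a, zmod_morphism (@r x y a))
    (r_id : forall x m, r x x (idmor x) m = m)
    (r_comp : forall x y z (b : hom y z) (a : hom x y) m,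
      r _ _ (compmor b a) m = r _ _ a (r _ _ b m)) : rmodule C :=
  @RModule C M (fun x y a => mk_additive (rB x y a)) r_id r_comp.

(** The image of an additive map, as an abelian group. *)
Record image_sort (U V : zmodType) (f : {additive U -> V}) := ImageElt {
  image_val : V; imageP : image_val \in range f }.

Section Image.
Variables (U V : zmodType) (f : {additive U -> V}).

Lemma image_zmod_closed : zmod_closed [in range f].
Proof.
split=> [|x y]; rewrite !inE; first by exists 0 => //; rewrite raddf0.
by move=> [u _ <-] [v _ <-]; exists (u - v); rewrite ?raddfB.
Qed.
HB.instance Definition _ := [isSub for @image_val U V f].
HB.instance Definition _ := [Choice of image_sort f by <:].
HB.instance Definition _ :=
  GRing.SubChoice_isSubZmodule.Build V _ (image_sort f) image_zmod_closed.

End Image.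

Section Modules.
Variable C : category.
Implicit Types L M N P Q : rmodule C.

Definition mk_rmodhom M N (f : forall x, M x -> N x)
    (fB : forall x, zmod_morphism (f x))
    (f_nat : forall x y (a : hom x y) m, f x (res M a m) = res N a (f y m)) :
    rmodhom M N :=
  @RModHom C M N (fun x => mk_additive (fB x)) f_nat.

Lemma res_image_subproof M N (f : rmodhom M N) x y (a : hom x y)
  (u : image_sort (f y)) : res N a (val u) \in range (f x).
Proof.
case: u => /= n; rewrite !inE => -[m _ <-].
by exists (res M a m) => //; rewrite rmodhom_nat.
Qed.

Definition res_image_fun M N (f : rmodhom M N) x y (a : hom x y)
  (u : image_sort (f y)) : image_sort (f x) :=
  ImageElt (res_image_subproof a u).

(** The image of a morphism of modules, as a module. *)
Definition image_module M N (f : rmodhom M N) : rmodule C.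
Proof.
refine (@mk_rmodule C (fun x => image_sort (f x)) (@res_image_fun M N f) _ _ _).
- by move=> x y a u v; apply: val_inj; rewrite /= raddfB.
- by move=> x u; apply: val_inj; rewrite /= res_id.
- by move=> x y z b a u; apply: val_inj; rewrite /= res_comp.
Defined.

Lemma corestrict_subproof M N (f : rmodhom M N) P (g : rmodhom P N) x (p : P x) :
  (forall x (p : P x), range (f x) (g x p)) -> g x p \in range (f x).
Proof. by move=> gf; rewrite inE. Qed.

Definition corestrict M N (f : rmodhom M N) P (g : rmodhom P N)
  (gf : forall x (p : P x), range (f x) (g x p)) : rmodhom P (image_module f).
Proof.
refine (@mk_rmodhom P (image_module f)
  (fun x p => ImageElt (corestrict_subproof p gf)) _ _).
- by move=> x u v; apply: val_inj; rewrite /= raddfB.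
- by move=> x y b m; apply: val_inj; rewrite /= rmodhom_nat.
Defined.

(** A morphism from a projective module whose values are all values of [f]
lifts along [f]. *)
Lemma projective_lift P M N (f : rmodhom M N) (g : rmodhom P N) :
  projective P -> (forall x (p : P x), range (f x) (g x p)) ->
  exists h : rmodhom P M, forall x (p : P x), f x (h x p) = g x p.
Proof.
move=> Pproj gf.
have ff x (m : M x) : range (f x) (f x m) by exists m.
have [|h hP] := Pproj _ _ (corestrict ff) (corestrict gf).
  move=> x; rewrite -subTset => -[n nf] _.
  have := nf; rewrite inE => -[m _ fm]; exists m => //.
  exact: val_inj.
by exists h => x p; have /(congr1 val) := hP x p.
Qed.

End Modules.

(** * Chain maps and mapping cones *)

Section Cone.
Variable C : category.
Implicit Types L M N P Q : rmodule C.

Lemma exact_at_comp L M N (f : rmodhom L M) (g : rmodhom M N) x (l : L x) :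
  exact_at f g -> g x (f x l) = 0.
Proof.
move=> /(_ x) fg; have : range (f x) (f x l) by exists l.
by rewrite fg.
Qed.

Lemma exact_at_lift L M N (f : rmodhom L M) (g : rmodhom M N) x (m : M x) :
  exact_at f g -> g x m = 0 -> exists l, f x l = m.
Proof.
move=> /(_ x) fg gm0.
have : range (f x) m by rewrite fg.
by move=> [l _ <-]; exists l.
Qed.

Definition rmodhom_comp L M N (g : rmodhom M N) (f : rmodhom L M) :
  rmodhom L N.
Proof.
refine (@mk_rmodhom C L N (fun x l => g x (f x l)) _ _).
- by move=> x u v; rewrite !raddfB.
- by move=> x y b m; rewrite !rmodhom_nat.
Defined.

(** The comparison theorem: a morphism [a] between augmented modules extends
to a chain map from a complex of projectives to a resolution. *)
Lemma chain_lift M N (a : rmodhom M N)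
    (P : nat -> rmodule C) (dP : forall k, rmodhom (P k.+1) (P k))
    (epsP : rmodhom (P 0%N) M)
    (Q : nat -> rmodule C) (dQ : forall k, rmodhom (Q k.+1) (Q k))
    (epsQ : rmodhom (Q 0%N) N) :
  (forall k, projective (P k)) ->
  (forall x p, epsP x (dP 0%N x p) = 0) ->
  (forall k x p, dP k x (dP k.+1 x p) = 0) ->
  epi epsQ -> exact_at (dQ 0%N) epsQ ->
  (forall k, exact_at (dQ k.+1) (dQ k)) ->
  exists phi : forall k, rmodhom (P k) (Q k),
    (forall x p, epsQ x (phi 0%N x p) = a x (epsP x p)) /\
    (forall k x p, dQ k x (phi k.+1 x p) = phi k x (dP k x p)).
Proof.
move=> Pproj epsdP ddP epsQ_epi exQ0 exQ.
(* the condition under which a map in degree k extends to degree k + 1 *)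
pose S k (f : rmodhom (P k) (Q k)) :=
  forall x (p : P k.+1 x), range (dQ k x) (f x (dP k x p)).
have [|f0 f0P] := projective_lift (f := epsQ) (g := rmodhom_comp a epsP)
    (Pproj 0%N).
  by move=> x p; rewrite (epsQ_epi x).
have f0S : S 0%N f0.
  move=> x p; have [|q <-] := exact_at_lift (m := f0 x (dP 0%N x p)) exQ0.
    by rewrite f0P /= epsdP raddf0.
  by exists q.
have step k (t : {f | S k f}) : {t' : {f | S k.+1 f} |
    forall x p, dQ k x (sval t' x p) = sval t x (dP k x p)}.
  apply: cid; case: t => f fS /=.
  have [|g gP] := projective_lift (f := dQ k) (g := rmodhom_comp f (dP k))
    (Pproj k.+1) _; first exact: fS.
  have gS : S k.+1 g.
    move=> x p.
    have [|q <-] := exact_at_lift (m := g x (dP k.+1 x p)) (exQ k).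
      by rewrite gP /= ddP raddf0.
    by exists q.
  by exists (exist _ g gS).
pose t := fix t k : {f | S k f} :=
  if k is k'.+1 then sval (step k' (t k')) else exist _ f0 f0S.
exists (fun k => sval (t k)); split; first exact: f0P.
by move=> k x p; rewrite /= (svalP (step k (t k))).
Qed.

Section DirectSum.
Variables M N : rmodule C.

(** The direct sum of two modules. *)
Definition sum_module : rmodule C.
Proof.
refine (@mk_rmodule C (fun x => (M x * N x)%type)
  (fun x y a u => (res M a u.1, res N a u.2)) _ _ _).
- by move=> x y a u v; rewrite /= !raddfB.
- by move=> x [m n]; rewrite /= !res_id.
- by move=> x y z b a [m n]; rewrite /= !res_comp.
Defined.

Definition sum_inl : rmodhom M sum_module.
Proof.
refine (@mk_rmodhom C M sum_module (fun x m => (m, 0)) _ _).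
- by move=> x u v; congr pair; rewrite ?subr0.
- by move=> x y a m; rewrite /= ?raddf0.
Defined.

Definition sum_inr : rmodhom N sum_module.
Proof.
refine (@mk_rmodhom C N sum_module (fun x n => (0, n)) _ _).
- by move=> x u v; congr pair; rewrite ?subr0.
- by move=> x y a m; rewrite /= ?raddf0.
Defined.

Definition sum_elim L (f : rmodhom M L) (g : rmodhom N L) :
  rmodhom sum_module L.
Proof.
refine (@mk_rmodhom C sum_module L (fun x u => f x u.1 + g x u.2) _ _).
- by move=> x u v; rewrite /= !raddfB opprD addrACA.
- by move=> x y a m; rewrite /= !rmodhom_nat raddfD.
Defined.

Lemma projective_sum : projective M -> projective N -> projective sum_module.
Proof.
move=> Mproj Nproj K L e f e_epi.
have [g gP] := Mproj _ _ _ (rmodhom_comp f sum_inl) e_epi.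
have [h hP] := Nproj _ _ _ (rmodhom_comp f sum_inr) e_epi.
exists (sum_elim g h) => x [m n] /=; rewrite raddfD /= gP hP /= -raddfD.
by congr (f x _); congr pair; rewrite /= ?addr0 ?add0r.
Qed.

End DirectSum.

Section MappingCone.
Variables (P Q : nat -> rmodule C).
Variables (dP : forall k, rmodhom (P k.+1) (P k)).
Variables (dQ : forall k, rmodhom (Q k.+1) (Q k)).
Variable phi : forall k, rmodhom (P k) (Q k).

(** The mapping cone of a chain map [phi] from [P] to [Q]: it is
[Q (k + 1) (+) P k] in degree [k + 1], and [Q 0] in degree 0. *)
Definition cone_module k : rmodule C :=
  if k is k'.+1 then sum_module (Q k) (P k') else Q 0%N.

(** The differential [(q, p) |-> (d q + phi p, - d p)]. *)
Definition cone_diff_fun k x : cone_module k.+1 x -> cone_module k x :=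
  match k return cone_module k.+1 x -> cone_module k x with
  | 0 => fun u => dQ 0 x u.1 + phi 0 x u.2
  | k'.+1 => fun u => (dQ k'.+1 x u.1 + phi k'.+1 x u.2, - dP k' x u.2)
  end.

Definition cone_diff k : rmodhom (cone_module k.+1) (cone_module k).
Proof.
refine (@mk_rmodhom C _ _ (@cone_diff_fun k) _ _).
- case: k => [|k] x u v; first by rewrite /= !raddfB opprD addrACA.
  by congr pair; rewrite /= !raddfB ?opprD ?opprK // addrACA.
- case: k => [|k] x y a u /=; first by rewrite !rmodhom_nat raddfD.
  by rewrite !rmodhom_nat raddfD raddfN.
Defined.

End MappingCone.

(** If [0 -> A -> B -> L -> 0] is exact and [A] and [B] have projective
resolutions of length [n], then the mapping cone of a chain map covering
[A -> B] is a projective resolution of [L], of length [n + 1]. *)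
Lemma proj_resolution_coker A B L (f : rmodhom A B) (g : rmodhom B L) n :
  (forall x, injective (f x)) -> exact_at f g -> epi g ->
  proj_resolution_of_length A n -> proj_resolution_of_length B n ->
  proj_resolution_of_length L n.+1.
Proof.
move=> f_inj fg g_epi [P [dP [epsP [Pproj epsP_epi exP0 exP P0]]]].
move=> [Q [dQ [epsQ [Qproj epsQ_epi exQ0 exQ Q0]]]].
have epsdP x p : epsP x (dP 0%N x p) = 0 by exact: exact_at_comp.
have epsdQ x p : epsQ x (dQ 0%N x p) = 0 by exact: exact_at_comp.
have ddP k x p : dP k x (dP k.+1 x p) = 0 by exact: exact_at_comp.
have ddQ k x p : dQ k x (dQ k.+1 x p) = 0 by exact: exact_at_comp.
have [phi [eps_phi d_phi]] :=
  chain_lift f Pproj epsdP ddP epsQ_epi exQ0 exQ.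
exists (cone_module P Q), (cone_diff dP dQ phi), (rmodhom_comp g epsQ).
split.
- by case=> [|k]; [exact: Qproj | exact: projective_sum].
- move=> x; rewrite -subTset => l _.
  have : range (g x) l by rewrite g_epi.
  move=> [b _ <-]; have : range (epsQ x) b by rewrite epsQ_epi.
  by move=> [q _ <-]; exists q.
- move=> x; rewrite eqEsubset; split=> [_ [[q p] _ <-]|q] /=.
    by rewrite raddfD /= epsdQ add0r eps_phi (exact_at_comp _ fg).
  move=> /(exact_at_lift fg)[a fa].
  have : range (epsP x) a by rewrite epsP_epi.
  move=> [p _ epsp].
  have [|q' dq'] := exact_at_lift (m := q - phi 0%N x p) exQ0.
    by rewrite raddfB /= eps_phi epsp fa subrr.
  by exists (q', p) => //=; rewrite dq' subrK.
- (* if dP p' = p, then (q, p) in the kernel is the image of some (q', - p') *)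
  have cone_lift k x (q : Q k.+1 x) (p : P k x) (p' : P k.+1 x) :
      dQ k x q + phi k x p = 0 -> dP k x p' = p ->
      exists q', dQ k.+1 x q' + phi k.+1 x (- p') = q.
    move=> dqp dp'.
    have [|q' dq'] := exact_at_lift (m := q + phi k.+1 x p') (exQ k).
      by rewrite raddfD /= d_phi dp'.
    by exists q'; rewrite dq' raddfN addrK.
  case=> [|k] x; rewrite eqEsubset; split=> [_ [[q p] _ <-]|[q p]] /=.
  + by rewrite raddfD /= ddQ add0r d_phi raddfN subrr.
  + move=> dqp.
    have [|p' dp'] := exact_at_lift (m := p) exP0.
      apply: (f_inj x); rewrite raddf0 -eps_phi.
      by rewrite -[phi _ _ _](addKr (dQ 0%N x q)) dqp addr0 raddfN /= epsdQ oppr0.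
    have [q' q'E] := cone_lift _ _ _ _ _ dqp dp'.
    by exists (q', - p') => //=; rewrite q'E raddfN opprK dp'.
  + congr pair; last by rewrite raddfN /= ddP !oppr0.
    by rewrite raddfD /= ddQ add0r d_phi raddfN subrr.
  + case=> dqp /(congr1 -%R); rewrite opprK oppr0 => dp0.
    have [|p' dp'] := exact_at_lift (m := p) (exP k); first by [].
    have [q' q'E] := cone_lift _ _ _ _ _ dqp dp'.
    by exists (q', - p') => //=; rewrite q'E raddfN opprK dp'.
- case=> // k; rewrite ltnS => nk x [q p]; congr pair.
  + by apply: Q0; exact: leqW.
  + exact: P0.
Qed.

End Cone.

(** * Direct sums of abelian groups *)

(** The direct sum of a family of abelian groups, as the group of families
with finite support. *)
Record dsum (I : Type) (M : I -> zmodType) := Dsum {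
  dsum_fun :> forall i, M i;
  dsum_finite : finite_set [set i | dsum_fun i <> 0] }.

Section DsumZmodule.
Variables (I : Type) (M : I -> zmodType).
Implicit Types s t : dsum M.

Lemma dsumP s t : (forall i, s i = t i) -> s = t.
Proof.
case: s t => s sfin [t tfin] st.
have {}st : s = t by exact: functional_extensionality_dep.
by case: t / st tfin => tfin; rewrite (Prop_irrelevance sfin tfin).
Qed.

Lemma dsum_zero_subproof : finite_set [set i | (0 : M i) <> 0].
Proof. by apply: sub_finite_set (finite_set0 I) => i /=. Qed.
Definition dsum_zero := Dsum dsum_zero_subproof.

Lemma dsum_opp_subproof s : finite_set [set i | - s i <> 0].
Proof.
apply: sub_finite_set (dsum_finite s) => i /= + si0; apply.
by rewrite si0 oppr0.
Qed.
Definition dsum_opp s := Dsum (dsum_opp_subproof s).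

Lemma dsum_add_subproof s t : finite_set [set i | s i + t i <> 0].
Proof.
apply: sub_finite_set (_ : finite_set ([set i | s i <> 0] `|` [set i | t i <> 0])).
  move=> i /= st; apply: contrapT => /not_orP[/contrapT s0 /contrapT t0].
  by apply: st; rewrite s0 t0 addr0.
by rewrite finite_setU; split; exact: dsum_finite.
Qed.
Definition dsum_add s t := Dsum (dsum_add_subproof s t).

HB.instance Definition _ := gen_eqMixin (dsum M).
HB.instance Definition _ := gen_choiceMixin (dsum M).

Lemma dsum_addA : associative dsum_add.
Proof. by move=> s t u; apply: dsumP => i /=; rewrite addrA. Qed.
Lemma dsum_addC : commutative dsum_add.
Proof. by move=> s t; apply: dsumP => i /=; rewrite addrC. Qed.
Lemma dsum_add0 : left_id dsum_zero dsum_add.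
Proof. by move=> s; apply: dsumP => i /=; rewrite add0r. Qed.
Lemma dsum_addN : left_inverse dsum_zero dsum_opp dsum_add.
Proof. by move=> s; apply: dsumP => i /=; rewrite addNr. Qed.

HB.instance Definition _ :=
  GRing.isZmodule.Build (dsum M) dsum_addA dsum_addC dsum_add0 dsum_addN.

End DsumZmodule.

Section DsumTheory.
Variables (I : Type) (M : I -> zmodType).
Implicit Types s t : dsum M.

Lemma dsumBE s t i : (s - t) i = s i - t i. Proof. by []. Qed.
(* [eq_rect] transports [m] to the summand of the equal index [j]. *)
Definition single_fun i (m : M i) j : M j :=
  if pselect (i = j) is left e then eq_rect i M m j e else 0.

Lemma single_fun_neq i (m : M i) j : i <> j -> single_fun m j = 0.
Proof. by rewrite /single_fun; case: pselect. Qed.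

Lemma single_subproof i (m : M i) : finite_set [set j | single_fun m j <> 0].
Proof.
apply: sub_finite_set (finite_set1 i) => j /= mj; apply: contrapT => ji.
by apply: mj; rewrite single_fun_neq // => /esym.
Qed.

(** The element [m] of the summand of index [i]. *)
Definition single i (m : M i) : dsum M := Dsum (single_subproof m).

Lemma single_eq i (m : M i) : single m i = m.
Proof.
by rewrite /= /single_fun; case: pselect => // e; rewrite (Prop_irrelevance e erefl).
Qed.

Lemma single_neq i (m : M i) j : i <> j -> single m j = 0.
Proof. exact: single_fun_neq. Qed.

Lemma singleB i : zmod_morphism (@single i).
Proof.
move=> m n; apply: dsumP => j; rewrite dsumBE.
case: (pselect (i = j)) => [<-|ij]; first by rewrite !single_eq.
by rewrite !single_neq // subr0.
Qed.
HB.instance Definition _ i :=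
  GRing.isZmodMorphism.Build (M i) (dsum M) (@single i) (@singleB i).
Definition single_additive i : {additive M i -> dsum M} := @single i.

(** A direct sum is generated by its summands. *)
Lemma dsum_ind (P : dsum M -> Prop) :
  P 0 -> (forall s t, P s -> P t -> P (s + t)) ->
  (forall i m, P (@single i m)) -> forall s, P s.
Proof.
move=> P0 PD P1 s.
have /(@finite_seqP {classic I})[r sr] := dsum_finite s.
have {sr} : forall i : {classic I}, s i <> 0 -> i \in r.
  by move=> i si0; have : [set i | s i <> 0] i by []; rewrite sr.
elim: r s => [|i r IHr] s sr.
  suff -> : s = 0 by [].
  by apply: dsumP => i; apply: contrapT => /sr.
rewrite -[s](subrK (single (s i))); apply: PD => //; apply: IHr => j.
rewrite dsumBE; case: (pselect (i = j)) => [<-|ij].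
  by rewrite single_eq subrr.
rewrite single_neq // subr0 => /sr; rewrite inE => /orP[/eqP ji|//].
by case: ij.
Qed.

Lemma dsum_hom_eq (A : zmodType) (f g : {additive dsum M -> A}) :
  (forall i m, f (@single i m) = g (@single i m)) -> f =1 g.
Proof.
move=> fg; apply: dsum_ind => [|s t fs ft|//]; first by rewrite !raddf0.
by rewrite !raddfD fs ft.
Qed.

Section Elim.
Variables (A : zmodType) (phi : forall i, {additive M i -> A}).

Definition dsum_elim_fun s : A :=
  \sum_(i \in ([set i | s i <> 0] : set {classic I})) phi i (s i).

Lemma dsum_elim_funE (D : set {classic I}) s : [set i | s i <> 0] `<=` D ->
  dsum_elim_fun s = \sum_(i \in D) phi i (s i).
Proof.
move=> sD; apply: fsbig_widen => // i [_ /contrapT si0] /=.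
by rewrite si0 raddf0.
Qed.

Lemma dsum_elimB : zmod_morphism dsum_elim_fun.
Proof.
move=> s t.
pose D : set {classic I} := [set i | s i <> 0] `|` [set i | t i <> 0].
have Dfin : finite_set D by rewrite finite_setU; split; exact: dsum_finite.
have stD : [set i | (s - t) i <> 0] `<=` D.
  move=> i /= st; apply: contrapT => /not_orP[/contrapT s0 /contrapT t0].
  by apply: st; rewrite s0 t0 subr0.
rewrite (dsum_elim_funE stD) (@dsum_elim_funE D s) ?(@dsum_elim_funE D t);
  [|by move=> i; right|by move=> i; left].
rewrite !fsbig_finite // -sumrB; apply: eq_bigr => i _.
by rewrite dsumBE raddfB.
Qed.

(** The additive map out of a direct sum induced by maps out of the summands. *)
Definition dsum_elim : {additive dsum M -> A} := mk_additive dsum_elimB.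

Lemma dsum_elim_single i (m : M i) : dsum_elim (single m) = phi i m.
Proof.
rewrite /= (@dsum_elim_funE [set i]) ?fsbig_set1 ?single_eq // => j /=.
by move=> mj; apply: contrapT => ji; apply: mj; rewrite single_fun_neq // => /esym.
Qed.

End Elim.
End DsumTheory.

(** * Induction along a family of functors *)

Lemma dep_choice (T : Type) (U : T -> Type) (P : forall x, U x -> Prop) :
  (forall x, exists y, P x y) -> exists f : forall x, U x, forall x, P x (f x).
Proof.
by move=> H; exists (fun x => sval (cid (H x))) => x; exact: svalP (cid (H x)).
Qed.

Section DsumMap.
Variables (I : Type) (M N : I -> zmodType).
Variable f : forall i, {additive M i -> N i}.

Lemma dsum_map_subproof (s : dsum M) : finite_set [set i | f i (s i) <> 0].
Proof.
apply: sub_finite_set (dsum_finite s) => i /= + si0; apply.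
by rewrite si0 raddf0.
Qed.

(** The map of direct sums that is [f i] on the summand of index [i]. *)
Definition dsum_map (s : dsum M) : dsum N := Dsum (dsum_map_subproof s).

Lemma dsum_mapB : zmod_morphism dsum_map.
Proof. by move=> s t; apply: dsumP => i; rewrite /= raddfB. Qed.
HB.instance Definition _ :=
  GRing.isZmodMorphism.Build (dsum M) (dsum N) dsum_map dsum_mapB.

Lemma dsum_map_single i (m : M i) : dsum_map (single m) = single (f i m).
Proof.
apply: dsumP => j; case: (pselect (i = j)) => [<-|ij].
  by rewrite single_eq -[LHS]/(f i (single m i)) single_eq.
by rewrite single_neq // -[LHS]/(f j (single m j)) single_neq // raddf0.
Qed.

(** Preimages of the components have finite support when 0 is chosen over 0. *)
Lemma dsum_map_range (t : dsum N) :
  (forall i, range (f i) (t i)) -> range dsum_map t.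
Proof.
move=> tf.
have /dep_choice[s sP] i : exists m : M i, f i m = t i /\ (t i = 0 -> m = 0).
  case: (pselect (t i = 0)) => [->|ti0]; first by exists 0; rewrite raddf0.
  by have [m _ mt] := tf i; exists m.
have sfin : finite_set [set i | s i <> 0].
  apply: sub_finite_set (dsum_finite t) => i /= + ti0; apply.
  by have [_ ->] := sP i.
exists (Dsum sfin) => //; apply: dsumP => i.
by have [] := sP i.
Qed.

End DsumMap.

Record functor (D C : category) := Functor {
  fob :> ob D -> ob C;
  fmor : forall x y, hom x y -> hom (fob x) (fob y);
  fmor_id : forall x, fmor (idmor x) = idmor (fob x);
  fmor_comp : forall x y z (g : hom y z) (f : hom x y),
    fmor (compmor g f) = compmor (fmor g) (fmor f) }.

(** A multi-adjoint on the left of [Phi]: every comma category [L / Phi] is a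
disjoint union, indexed by [adj_ix L], of categories with an initial object
[adj_unit i : L -> Phi (adj_ob i)]. *)
Record multiadjoint (D C : category) (Phi : functor D C) := Multiadjoint {
  adj_ix : ob C -> Type;
  adj_ob : forall L, adj_ix L -> ob D;
  adj_unit : forall L (i : adj_ix L), hom L (Phi (adj_ob i));
  factor : forall L d, hom L (Phi d) -> {i : adj_ix L & hom (adj_ob i) d};
  factorK : forall L d (f : hom L (Phi d)),
    compmor (fmor Phi (projT2 (factor f))) (adj_unit (projT1 (factor f))) = f;
  factor_uniq : forall L d (i : adj_ix L) (u : hom (adj_ob i) d),
    factor (compmor (fmor Phi u) (adj_unit i)) = existT _ i u }.

(** The restriction of a module over [C] along a functor to [C]. *)
Definition pullback_module (D C : category) (Phi : functor D C) (N : rmodule C) :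
  rmodule D.
Proof.
refine (@mk_rmodule D (fun d => N (Phi d))
  (fun x y a m => res N (fmor Phi a) m) _ _ _).
- by move=> x y a u v; rewrite /= raddfB.
- by move=> x m; rewrite fmor_id res_id.
- by move=> x y z b a m; rewrite fmor_comp res_comp.
Defined.

Definition pullback_hom (D C : category) (Phi : functor D C) (M N : rmodule C)
  (f : rmodhom M N) : rmodhom (pullback_module Phi M) (pullback_module Phi N).
Proof.
refine (@mk_rmodhom D (pullback_module Phi M) (pullback_module Phi N)
  (fun d m => f (Phi d) m) _ _).
- by move=> x u v; rewrite raddfB.
- by move=> x y a m; rewrite /= rmodhom_nat.
Defined.

Section Induction.
Variables (C : category) (K : Type) (D : K -> category).
Variables (Phi : forall k, functor (D k) C).
Variable (A : forall k, multiadjoint (Phi k)).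

Section InducedModule.
Variable M : forall k, rmodule (D k).

Definition ind_sort (L : ob C) : zmodType :=
  dsum (fun j : {k : K & adj_ix (A k) L} => M (projT1 j) (adj_ob (projT2 j))).

Definition ind_single L k (i : adj_ix (A k) L) (m : M k (adj_ob i)) :
  ind_sort L :=
  @single {k : K & adj_ix (A k) L}
    (fun j => M (projT1 j) (adj_ob (projT2 j))) (existT _ k i) m.

(** The image of [m] in the summand through which a factorization goes. *)
Definition ind_factored L k (d : ob (D k))
    (p : {i : adj_ix (A k) L & hom (adj_ob i) d}) (m : M k d) : ind_sort L :=
  ind_single (res (M k) (projT2 p) m).

(** The element of the induced module at [L] represented by a morphism
[f : L -> Phi d] and an element [m] of [M] at [d]. *)
Definition ind_elt L k (d : ob (D k)) (f : hom L (Phi k d)) (m : M k d) :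
  ind_sort L :=
  ind_factored (factor (A k) f) m.

Lemma ind_eltB L k (d : ob (D k)) (f : hom L (Phi k d)) :
  zmod_morphism (@ind_elt L k d f).
Proof. by move=> m n; rewrite /ind_elt /ind_factored /ind_single !raddfB. Qed.
HB.instance Definition _ L k (d : ob (D k)) (f : hom L (Phi k d)) :=
  GRing.isZmodMorphism.Build (M k d) (ind_sort L) (@ind_elt L k d f)
    (@ind_eltB L k d f).

Lemma ind_elt_unit L k (i : adj_ix (A k) L) (m : M k (adj_ob i)) :
  ind_elt (adj_unit i) m = ind_single m.
Proof.
rewrite /ind_elt.
have -> : adj_unit i = compmor (fmor (Phi k) (idmor _)) (adj_unit i).
  by rewrite fmor_id comp1mor.
by rewrite factor_uniq /ind_factored /= res_id.
Qed.

(** [ind_elt] is balanced, as a tensor product over [D k] should be. *)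
Lemma ind_elt_comp L k (d d' : ob (D k)) (v : hom d d') (f : hom L (Phi k d)) m :
  ind_elt (compmor (fmor (Phi k) v) f) m = ind_elt f (res (M k) v m).
Proof.
rewrite /ind_elt -[in LHS](factorK (A k) f).
case: (factor (A k) f) => i u /=.
by rewrite compmorA -fmor_comp factor_uniq /ind_factored /= res_comp.
Qed.

Lemma ind_hom_eq L (B : zmodType) (f g : {additive ind_sort L -> B}) :
  (forall k (d : ob (D k)) (a : hom L (Phi k d)) (m : M k d),
    f (ind_elt a m) = g (ind_elt a m)) -> f =1 g.
Proof.
move=> fg; apply: dsum_hom_eq => -[k i] m.
by have := fg _ _ (adj_unit i) m; rewrite ind_elt_unit.
Qed.

(** Restriction along [a] sends the summand of [i] to that of the component of
[adj_unit i] composed with [a]. *)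
Definition ind_res L L' (a : hom L' L) : {additive ind_sort L -> ind_sort L'} :=
  dsum_elim (fun j : {k : K & adj_ix (A k) L} =>
    ind_elt (compmor (adj_unit (projT2 j)) a)).

Lemma ind_res_elt L L' (a : hom L' L) k (d : ob (D k)) (f : hom L (Phi k d)) m :
  ind_res a (ind_elt f m) = ind_elt (compmor f a) m.
Proof.
rewrite /ind_res dsum_elim_single /=.
by rewrite -ind_elt_comp compmorA factorK.
Qed.

(** The module induced from the family [M], that is, the left Kan extension:
at [L] it is the direct sum of the values of [M] at all the [adj_ob i]. *)
Definition ind_module : rmodule C.
Proof.
refine (@RModule C ind_sort (fun L' L a => ind_res a) _ _).
- move=> L; apply: (@ind_hom_eq _ _ (ind_res (idmor L)) idfun) => k d f m.
  by rewrite ind_res_elt compmor1.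
- move=> x y z b a.
  apply: (@ind_hom_eq _ _ (ind_res (compmor b a)) (ind_res a \o ind_res b)).
  move=> k d f m.
  by rewrite -[RHS]/(ind_res a (ind_res b (ind_elt f m))) !ind_res_elt compmorA.
Defined.

Lemma ind_module_res_elt L L' (a : hom L' L) k (d : ob (D k))
    (f : hom L (Phi k d)) m :
  res ind_module a (ind_elt f m) = ind_elt (compmor f a) m.
Proof. exact: ind_res_elt. Qed.

Section IndElim.
Variables (N : rmodule C).
Variable (h : forall k, rmodhom (M k) (pullback_module (Phi k) N)).

Definition ind_elim_fun L : {additive ind_sort L -> N L} :=
  dsum_elim (fun j : {k : K & adj_ix (A k) L} =>
    res N (adj_unit (projT2 j)) \o h (projT1 j) (adj_ob (projT2 j))).

Lemma ind_elim_fun_elt L k (d : ob (D k)) (f : hom L (Phi k d)) m :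
  ind_elim_fun L (ind_elt f m) = res N f (h k d m).
Proof.
rewrite /ind_elim_fun dsum_elim_single /= rmodhom_nat /= -res_comp.
by rewrite factorK.
Qed.

(** The adjunct of a family of morphisms to the pullbacks of [N]. *)
Definition ind_elim : rmodhom ind_module N.
Proof.
refine (@RModHom C ind_module N ind_elim_fun _) => x y f.
apply: (@ind_hom_eq _ _ (ind_elim_fun x \o ind_res f) (res N f \o ind_elim_fun y)).
move=> k d a m.
rewrite -[LHS]/(ind_elim_fun x (ind_res f (ind_elt a m))).
rewrite -[RHS]/(res N f (ind_elim_fun y (ind_elt a m))).
by rewrite ind_res_elt !ind_elim_fun_elt res_comp.
Defined.

Lemma ind_elim_elt L k (d : ob (D k)) (f : hom L (Phi k d)) m :
  ind_elim L (ind_elt f m) = res N f (h k d m).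
Proof. exact: ind_elim_fun_elt. Qed.

End IndElim.

(** The unit of the adjunction between induction and pullback. *)
Definition ind_unit k : rmodhom (M k) (pullback_module (Phi k) ind_module).
Proof.
refine (@mk_rmodhom _ (M k) (pullback_module (Phi k) ind_module)
  (fun d m => ind_elt (idmor (Phi k d)) m) _ _).
- by move=> d u v; rewrite raddfB.
- move=> x y a m; rewrite /= -ind_elt_comp compmor1.
  by have := ind_res_elt (fmor (Phi k) a) (idmor (Phi k y)) m; rewrite comp1mor.
Defined.

(** Pullback along a functor is exact, so its left adjoint preserves
projectives. *)
Lemma projective_ind : (forall k, projective (M k)) -> projective ind_module.
Proof.
move=> Mproj P N e f e_epi.
have /dep_choice[g gP] k : exists g : rmodhom (M k) (pullback_module (Phi k) P),
    forall d m, e (Phi k d) (g d m) = f (Phi k d) (ind_elt (idmor (Phi k d)) m).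
  have [|g gP] := Mproj k _ _ (pullback_hom (Phi k) e)
    (rmodhom_comp (pullback_hom (Phi k) f) (ind_unit k)).
    by move=> d; exact: e_epi.
  by exists g => d m; rewrite gP.
exists (ind_elim g) => L.
apply: (@ind_hom_eq _ _ (e L \o ind_elim g L) (f L)) => k d a m.
rewrite -[LHS]/(e L (ind_elim g L (ind_elt a m))).
rewrite ind_elim_elt rmodhom_nat gP -rmodhom_nat.
by rewrite ind_module_res_elt comp1mor.
Qed.

End InducedModule.

Section IndMap.
Variables (M N : forall k, rmodule (D k)) (f : forall k, rmodhom (M k) (N k)).

Definition ind_map_fun L : {additive ind_sort M L -> ind_sort N L} :=
  dsum_map (fun j : {k : K & adj_ix (A k) L} => f (projT1 j) (adj_ob (projT2 j))).

Lemma ind_map_fun_elt L k (d : ob (D k)) (a : hom L (Phi k d)) m :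
  ind_map_fun L (ind_elt a m) = ind_elt a (f k d m).
Proof. by rewrite /= dsum_map_single /= rmodhom_nat. Qed.

(** The functoriality of induction. *)
Definition ind_map : rmodhom (ind_module M) (ind_module N).
Proof.
refine (@RModHom C (ind_module M) (ind_module N) ind_map_fun _) => x y a.
apply: (@ind_hom_eq _ _ _ (ind_map_fun x \o ind_res M a)
  (ind_res N a \o ind_map_fun y)).
move=> k d b m.
rewrite -[LHS]/(ind_map_fun x (ind_res M a (ind_elt b m))).
rewrite -[RHS]/(ind_res N a (ind_map_fun y (ind_elt b m))).
by rewrite ind_res_elt !ind_map_fun_elt ind_res_elt.
Defined.

End IndMap.

Lemma epi_ind_map (M N : forall k, rmodule (D k)) (f : forall k, rmodhom (M k) (N k)) :
  (forall k, epi (f k)) -> epi (ind_map f).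
Proof.
move=> f_epi L; rewrite -subTset => t _.
by apply: dsum_map_range => -[k i]; rewrite f_epi.
Qed.

(** Direct sums are exact; the values of the induced modules are direct sums. *)
Lemma exact_ind_map (M N P : forall k, rmodule (D k))
    (f : forall k, rmodhom (M k) (N k)) (g : forall k, rmodhom (N k) (P k)) :
  (forall k, exact_at (f k) (g k)) -> exact_at (ind_map f) (ind_map g).
Proof.
move=> fg L; rewrite eqEsubset; split=> [_ [s _ <-]|t /= gt0] /=.
  by apply: dsumP => j /=; exact: exact_at_comp (fg (projT1 j)).
apply: dsum_map_range => j; rewrite (fg (projT1 j)).
exact: (congr1 (fun s : dsum _ => s j) gt0).
Qed.

Lemma proj_resolution_ind (M : forall k, rmodule (D k)) n :
  (forall k, proj_resolution_of_length (M k) n) ->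
  proj_resolution_of_length (ind_module M) n.
Proof.
move=> /dep_choice[P] /dep_choice[d] /dep_choice[eps] HP.
exists (fun j => ind_module (fun k => P k j)), (fun j => ind_map (fun k => d k j)),
  (ind_map eps); split.
- by move=> j; apply: projective_ind => k; case: (HP k).
- by apply: epi_ind_map => k; case: (HP k).
- by apply: exact_ind_map => k; case: (HP k).
- by move=> j; apply: exact_ind_map => k; case: (HP k).
- move=> j nj L s; apply: dsumP => -[k i] /=.
  by have [_ _ _ _ P0] := HP k; exact: P0.
Qed.

End Induction.

(** * The mapping telescope of a graded set *)

(** The complex [1 - shift] followed by the augmentation, on the free abelian
group on a set [J] that is graded by [lev], with a map [t] of degree 1. *)
Section Telescope.
Variables (J : Type) (lev : J -> nat) (t : J -> J).
Hypothesis lev_t : forall j, lev (t j) = (lev j).+1.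
Local Notation Z_J := (dsum (fun _ : J => int)).
Local Notation sgl := (single_additive (fun _ : J => int)).

(** The map sending the generator of index [j] to that of index [t j]. *)
Definition shift : {additive Z_J -> Z_J} := 
  dsum_elim (M := fun=> int) (A := Z_J) 
    (fun j => sgl (t j)).

(** The augmentation: the sum of the coefficients. *)
Definition dsum_total : {additive Z_J -> int} := 
  dsum_elim (M := fun=> int) (A := int) (fun=> idfun).

Lemma one_minus_shiftB : zmod_morphism (fun s => s - shift s).
Proof. 
move=> u v; rewrite raddfB !opprB [shift v - shift u]addrC addrACA.
by rewrite [- v + _]addrC.
 Qed.

Lemma shift_single j z : shift (sgl j z) = sgl (t j) z.
Proof. exact: dsum_elim_single. Qed.

Lemma dsum_total_single j z : dsum_total (sgl j z) = z.
Proof. exact: dsum_elim_single. Qed.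

Lemma dsum_total_shift s : dsum_total (shift s) = dsum_total s.
Proof.
move: s; apply: (dsum_hom_eq (f := dsum_total \o shift)) => j z.
rewrite -[LHS]/(dsum_total (shift (sgl j z))).
by rewrite shift_single !dsum_total_single.
Qed.

Lemma mulrnB_additive n : zmod_morphism (fun z : int => z *+ n).
Proof. by move=> x y; rewrite mulrnBl. Qed.

(** The component of level [n] of a finitely supported family. *)
Definition truncation n : {additive Z_J -> Z_J} :=
  dsum_map (fun j => mk_additive (mulrnB_additive (lev j == n))).

Lemma truncation_single n j z :
  truncation n (sgl j z) = sgl j z *+ (lev j == n).
Proof. by rewrite -raddfMn; exact: dsum_map_single. Qed.

Lemma truncation0_shift s : truncation 0 (shift s) = 0.
Proof.
move: s; apply: (dsum_hom_eq (f := truncation 0 \o shift) (g := \0)) => j z.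
rewrite -[LHS]/(truncation 0 (shift (sgl j z))).
by rewrite shift_single truncation_single lev_t.
Qed.

Lemma truncationS_shift n s :
  truncation n.+1 (shift s) = shift (truncation n s).
Proof.
move: s; apply: (dsum_hom_eq (f := truncation n.+1 \o shift)
  (g := shift \o truncation n)) => j z.
rewrite -[LHS]/(truncation n.+1 (shift (sgl j z))).
rewrite -[RHS]/(shift (truncation n (sgl j z))).
by rewrite shift_single !truncation_single lev_t eqSS raddfMn shift_single.
Qed.

(** A fixed point of a map raising the levels has no component of level 0,
hence none of level 1, and so on. *)
Lemma shift_fixed s : shift s = s -> s = 0.
Proof.
move=> sE.
have s0 n : truncation n s = 0.
  elim: n => [|n IHn]; rewrite -sE; first exact: truncation0_shift.
  by rewrite truncationS_shift IHn raddf0.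
apply: dsumP => j; have := congr1 (fun u : Z_J => u j) (s0 (lev j)).
by rewrite /= eqxx.
Qed.

Lemma single_congr_iter j n z :
  exists u, sgl j z - sgl (iter n t j) z = u - shift u.
Proof.
elim: n => [|n [u uE]]; first by exists 0; rewrite !subrr raddf0 subrr.
exists (u + sgl (iter n t j) z).
by rewrite raddfD shift_single opprD addrACA -uE addrA subrK.
Qed.

(** Modulo the image of [1 - shift], all the generators become equal when any
two indices have a common iterate. *)
Lemma single_congr_total j0 s :
  (forall j, exists m n, iter m t j = iter n t j0) ->
  exists u, s - sgl j0 (dsum_total s) = u - shift u.
Proof.
move=> H; elim/dsum_ind: s => [|s s' [u uE] [u' uE']|j z].
- by exists 0; rewrite !raddf0.
- by exists (u + u'); rewrite !raddfD addrACA uE uE' addrACA.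
- rewrite -/(sgl j z) dsum_total_single; have [m [n mn]] := H j.
  have [u uE] := @single_congr_iter j m z.
  have [u' uE'] := @single_congr_iter j0 n z.
  exists (u - u'); rewrite one_minus_shiftB /= -uE -uE' mn.
  by rewrite opprB addrA subrK.
Qed.

End Telescope.

Arguments dsum_total {J}.

(** * The mapping telescope of a sequence of functors *)

Section TelescopeResolution.
Variables (C : category) (D : nat -> category).
Variables (Phi : forall k, functor (D k) C) (A : forall k, multiadjoint (Phi k)).
Variable step : forall k L, adj_ix (A k) L -> adj_ix (A k.+1) L.
Hypothesis step_nat : forall k L L' (a : hom L' L) (i : adj_ix (A k) L),
  step (projT1 (factor (A k) (compmor (adj_unit i) a))) =
  projT1 (factor (A k.+1) (compmor (adj_unit (step i)) a)).

(** The transition maps on the union over [k] of the index sets. *)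
Definition total_step L (j : {k : nat & adj_ix (A k) L}) :
    {k : nat & adj_ix (A k) L} :=
  existT _ (projT1 j).+1 (step (projT2 j)).

Hypothesis index_inhabited : forall L, exists j : {k : nat & adj_ix (A k) L}, True.
Hypothesis step_confluent : forall L (j j0 : {k : nat & adj_ix (A k) L}),
  exists m n, iter m (@total_step L) j = iter n (@total_step L) j0.

Let indZ := ind_module A (fun k => constZ (D k)).

(** The map [1 - shift] at [L]. *)
Definition telescope_fun L : indZ L -> indZ L :=
  fun s => s - shift (@total_step L) s.

Lemma res_indZ_single L L' (a : hom L' L) k (i : adj_ix (A k) L) (z : int) :
  res indZ a (single_additive (fun=> int) (existT _ k i) z) =
  single_additive (fun _ : {k : nat & adj_ix (A k) L'} => int)
    (existT _ k (projT1 (factor (A k) (compmor (adj_unit i) a)))) z.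
Proof. exact: dsum_elim_single. Qed.

Lemma shift_nat L L' (a : hom L' L) (s : indZ L) :
  shift (@total_step L') (res indZ a s) = res indZ a (shift (@total_step L) s).
Proof.
move: s; apply: (dsum_hom_eq (f := shift (@total_step L') \o res indZ a)
  (g := res indZ a \o shift (@total_step L))) => -[k i] z.
rewrite -[LHS]/(shift (@total_step L') (res indZ a
  (single_additive (fun=> int) (existT _ k i) z))).
rewrite -[RHS]/(res indZ a (shift (@total_step L)
  (single_additive (fun=> int) (existT _ k i) z))).
rewrite res_indZ_single !shift_single.
by rewrite [in RHS]/total_step res_indZ_single -step_nat.
Qed.

Definition telescope_map : rmodhom indZ indZ.
Proof.
refine (@mk_rmodhom C indZ indZ telescope_fun _ _).
- by move=> L; exact: one_minus_shiftB.
- by move=> L' L a s; rewrite /telescope_fun raddfB shift_nat.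
Defined.

(** The constant module pulls back to the constant module. *)
Definition constZ_hom k : rmodhom (constZ (D k)) (pullback_module (Phi k) (constZ C)) :=
  @mk_rmodhom (D k) (constZ (D k)) (pullback_module (Phi k) (constZ C))
    (fun _ => id) (fun _ _ _ => erefl) (fun _ _ _ _ => erefl).

Definition ind_augmentation : rmodhom indZ (constZ C) := ind_elim A constZ_hom.

Lemma ind_augmentation_total L (s : indZ L) : ind_augmentation L s = dsum_total s.
Proof.
move: s; apply: (dsum_hom_eq (f := ind_augmentation L)
  (g := @dsum_total {k : nat & adj_ix (A k) L})) => j z.
by rewrite /= [LHS]dsum_elim_single [RHS]dsum_elim_single.
Qed.

(** The mapping telescope [0 -> ind Z -> ind Z -> Z -> 0] is exact. *)
Theorem telescope_resolution n :
  (forall k, proj_resolution_of_length (constZ (D k)) n) ->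
  proj_resolution_of_length (constZ C) n.+1.
Proof.
move=> resZ; have resI := proj_resolution_ind A resZ.
apply: (proj_resolution_coker (f := telescope_map) (g := ind_augmentation)
  _ _ _ resI resI).
- move=> L; apply: raddf_inj => s /eqP.
  rewrite subr_eq0 => /eqP/esym.
  exact: (shift_fixed (lev := fun j => projT1 j)).
- move=> L; rewrite eqEsubset; split=> [_ [s _ <-]|s].
    rewrite -[_ _]/(ind_augmentation L (telescope_map L s) = 0).
    by rewrite ind_augmentation_total raddfB dsum_total_shift subrr.
  rewrite -[_ s]/(ind_augmentation L s = 0) ind_augmentation_total => s0.
  have [j0 _] := index_inhabited L.
  have [u uE] := single_congr_total s (fun j => step_confluent j j0).
  exists u => //; rewrite -[LHS]/(u - shift (@total_step L) u) -uE.
  by rewrite s0 raddf0 subr0.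
- move=> L; rewrite -subTset => z _.
  have [j0 _] := index_inhabited L.
  exists (single_additive (fun=> int) j0 z) => //.
  by rewrite ind_augmentation_total dsum_total_single.
Qed.

End TelescopeResolution.

(** * Maps between orbits as cosets *)

Local Close Scope ring_scope.
Local Open Scope group_scope.

Section GmapsAsCosets.
Variable G : groupType.
Implicit Types (H K L A B : set G) (g : G).

Definition set_mul A B : set G := [set a * b | a in A & b in B].

Lemma set_mulA A B L : set_mul A (set_mul B L) = set_mul (set_mul A B) L.
Proof.
rewrite eqEsubset; split=> x /=.
- move=> [a Aa] [_ [b Bb [l Ll <-]] <-]; exists (a * b); first by exists a => //; exists b.
  by exists l; rewrite // mulgA.
- move=> [_ [a Aa [b Bb <-]] [l Ll <-]]; exists a => //.
  by exists (b * l); [exists b => //; exists l | rewrite mulgA].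
Qed.

Lemma set_mul_ltrans g A B : set_mul (ltrans g A) B = ltrans g (set_mul A B).
Proof.
rewrite eqEsubset; split=> x /=.
- move=> [_ [a Aa <-] [b Bb <-]]; exists (a * b); first by exists a => //; exists b.
  by rewrite mulgA.
- move=> [_ [a Aa [b Bb <-]] <-]; exists (g * a); first by exists a.
  by exists b; rewrite // mulgA.
Qed.

Lemma ltrans1 A : ltrans 1 A = A.
Proof.
rewrite eqEsubset; split=> [_ [a Aa <-]|a Aa]; first by rewrite mul1g.
by exists a; rewrite // mul1g.
Qed.

Section Subgroup.
Variable H : set G.
Hypothesis Hgroup : is_subgroup H.

Lemma subgroup1 : H 1.
Proof. by case: Hgroup => /set_mem. Qed.

Lemma subgroupV g : H g -> H g^-1.
Proof.
by move=> Hg; apply/set_mem/(group_closedV Hgroup); exact: mem_set.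
Qed.

Lemma subgroupM g g' : H g -> H g' -> H (g * g').
Proof.
by move=> Hg Hg'; apply/set_mem/(group_closedM Hgroup); exact: mem_set.
Qed.

Lemma ltrans_subgroup g : H g -> ltrans g H = H.
Proof.
move=> Hg; rewrite eqEsubset; split=> [_ [h Hh <-]|h Hh].
  exact: subgroupM.
by exists (g^-1 * h); [apply: subgroupM => //; exact: subgroupV | rewrite mulVKg].
Qed.

Lemma coset_mem g : ltrans g H g.
Proof. by exists 1; [exact: subgroup1 | rewrite mulg1]. Qed.

Lemma coset_eq g b : ltrans g H b -> ltrans g H = ltrans b H.
Proof. by move=> [h Hh <-]; rewrite -ltransM (ltrans_subgroup Hh). Qed.

Lemma set_mul_stable B : (forall h, H h -> ltrans h B `<=` B) -> set_mul H B = B.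
Proof.
move=> HB; rewrite eqEsubset; split=> [_ [h Hh [b Bb <-]]|b Bb].
  by apply: (HB _ Hh); exists b.
by exists 1; [exact: subgroup1 | exists b; rewrite // mul1g].
Qed.

Lemma base_coset_subproof : exists g, H = ltrans g H.
Proof. by exists 1; rewrite ltrans1. Qed.

End Subgroup.

Definition base_coset H : lcosets H := exist _ H (base_coset_subproof H).

(** The image of the coset [H] under a [G]-map from [G/H] to [G/K]. When [H] is
a subgroup it determines the map, and composition becomes the product of
subsets. *)
Definition gimg H K (f : Gmap H K) : set G := sval (f (base_coset H)).

Lemma lcosetsP H (A B : lcosets H) : sval A = sval B -> A = B.
Proof.
case: A B => A pA [B pB] /= AB; case: B / AB pB => pB.
by rewrite (Prop_irrelevance pA pB).
Qed.

Lemma gimg_coset H K (f : Gmap H K) : exists g, gimg f = ltrans g K.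
Proof. by rewrite /gimg; case: (f _). Qed.

Lemma gimg_mem H K (f : Gmap H K) : is_subgroup K -> exists b, gimg f b.
Proof.
by move=> Kg; have [b ->] := gimg_coset f; exists b; exact: coset_mem.
Qed.

Lemma gimgE H K (f : Gmap H K) b : is_subgroup K -> gimg f b ->
  gimg f = ltrans b K.
Proof. by move=> Kg; have [c ->] := gimg_coset f; exact: coset_eq. Qed.

Lemma gimg_act H K (f : Gmap H K) g :
  sval (f (lcosets_act g (base_coset H))) = ltrans g (gimg f).
Proof. by rewrite Gmap_equiv. Qed.

Lemma gimg_stable H K (f : Gmap H K) h : is_subgroup H -> H h ->
  ltrans h (gimg f) = gimg f.
Proof.
move=> Hg Hh; rewrite -gimg_act; congr (sval (f _)).
by apply: lcosetsP; exact: ltrans_subgroup.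
Qed.

Lemma gimg_mul H K (f : Gmap H K) : is_subgroup H -> set_mul H (gimg f) = gimg f.
Proof. by move=> Hg; apply: set_mul_stable => // h Hh; rewrite gimg_stable. Qed.

Lemma Gmap_mulE H K (f : Gmap H K) (A : lcosets H) : is_subgroup H ->
  sval (f A) = set_mul (sval A) (gimg f).
Proof.
move=> Hg; case: A => A [g AE] /=; rewrite [in RHS]AE set_mul_ltrans gimg_mul //.
by rewrite -gimg_act; congr (sval (f _)); exact: lcosetsP.
Qed.

Lemma gimg_inj H K (f f' : Gmap H K) : is_subgroup H -> gimg f = gimg f' -> f = f'.
Proof.
move=> Hg ff'; apply: Gmap_eq => A; apply: lcosetsP.
by rewrite !Gmap_mulE // ff'.
Qed.

Lemma gimg_comp H K L (f' : Gmap K L) (f : Gmap H K) : is_subgroup K ->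
  gimg (Gmap_comp f' f) = set_mul (gimg f) (gimg f').
Proof. by move=> Kg; rewrite {1}/gimg /= Gmap_mulE. Qed.

Section MkGmap.
Variables (H K B : set G).
Hypothesis Hgroup : is_subgroup H.
Hypothesis B_coset : exists g, B = ltrans g K.
Hypothesis B_stable : forall h, H h -> ltrans h B `<=` B.

Lemma mk_gmap_subproof (A : lcosets H) : exists g, set_mul (sval A) B = ltrans g K.
Proof.
have [g ->] := svalP A; rewrite set_mul_ltrans set_mul_stable //.
by have [b ->] := B_coset; exists (g * b); rewrite ltransM.
Qed.

Definition mk_gmap_fun (A : lcosets H) : lcosets K :=
  exist _ (set_mul (sval A) B) (mk_gmap_subproof A).

Lemma mk_gmap_equiv g (A : lcosets H) :
  mk_gmap_fun (lcosets_act g A) = lcosets_act g (mk_gmap_fun A).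
Proof. by apply: lcosetsP; rewrite /= set_mul_ltrans. Qed.

(** The [G]-map from [G/H] to [G/K] sending [H] to an [H]-stable coset [B]. *)
Definition mk_gmap : Gmap H K := MkGmap mk_gmap_equiv.

Lemma gimg_mk_gmap : gimg mk_gmap = B.
Proof. exact: set_mul_stable. Qed.

End MkGmap.

(** A representative of the left coset [g S], which depends on the coset
only. *)
Definition coset_rep (S : groupClosed G) g : G := xget 1 [set x | x^-1 * g \in S].

Lemma coset_repP (S : groupClosed G) g : (coset_rep S g)^-1 * g \in S.
Proof.
rewrite /coset_rep; case: xgetP => [x _ //|/(_ g)] []; rewrite /= mulVg.
exact: gpred1.
Qed.

Lemma coset_rep_eq (S : groupClosed G) g g' : g^-1 * g' \in S ->
  coset_rep S g = coset_rep S g'.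
Proof.
move=> gg'; rewrite /coset_rep; congr (xget _ _); apply: eq_set => x.
by rewrite -[g'](mulVKg g) mulgA (gpredMr _ gg').
Qed.

Lemma coset_rep_rep (S T : groupClosed G) g : {subset S <= T} ->
  coset_rep T (coset_rep S g) = coset_rep T g.
Proof. by move=> ST; apply: coset_rep_eq; apply: ST; exact: coset_repP. Qed.

End GmapsAsCosets.

(** * Induction between orbit categories *)

Section OrbitInclusion.
Variables (G : groupType) (F : set (set G)).
Hypothesis F_family : is_family F.
Variable S : groupClosed G.
Local Notation S' := (subgroup_sort S).
Local Notation FS := (family_cap F S).
Implicit Types (A B : set S').

(** A subset of the subgroup [S], as a subset of [G]. *)
Definition incl A : set G := [set sgval a | a in A].

Lemma sgval_inj : injective (@sgval G S).
Proof. exact: val_inj. Qed.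

Lemma incl_sub A g : incl A g -> g \in S.
Proof. by move=> [a _ <-]; exact: sgvalP. Qed.

Lemma inclP A (a : S') : incl A (sgval a) -> A a.
Proof. by move=> [b Ab /sgval_inj <-]. Qed.

Lemma incl_inj : injective incl.
Proof.
move=> A B AB; rewrite eqEsubset; split=> a aA; apply: inclP.
  by rewrite -AB; exists a.
by rewrite AB; exists a.
Qed.

Lemma incl_preimage (B : set G) : (forall b, B b -> b \in S) ->
  incl (@sgval G S @^-1` B) = B.
Proof.
move=> BS; rewrite eqEsubset; split=> [_ [a Ba <-] //|b Bb].
by exists (SubgroupElt (BS _ Bb)).
Qed.

Lemma incl_ltrans (u : S') A : incl (ltrans u A) = ltrans (sgval u) (incl A).
Proof.
rewrite eqEsubset; split=> [_ [_ [a Aa <-] <-]|_ [_ [a Aa <-] <-]].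
  by exists (sgval a) => //; exists a.
by exists (u * a) => //; exists a.
Qed.

Lemma incl_mul A B : incl (set_mul A B) = set_mul (incl A) (incl B).
Proof.
rewrite eqEsubset; split.
- move=> _ [_ [a Aa [b Bb <-]] <-].
  by exists (sgval a); [exists a | exists (sgval b); first by exists b].
- move=> _ [_ [a Aa <-] [_ [b Bb <-] <-]].
  by exists (a * b) => //; exists a => //; exists b.
Qed.

Lemma is_subgroupP (T : groupType) (H : set T) : H 1 ->
  (forall x y, H x -> H y -> H (x * y^-1)) -> is_subgroup H.
Proof.
move=> H1 HF; split; first exact: mem_set.
by move=> x y /set_mem Hx /set_mem Hy; apply: mem_set; exact: HF.
Qed.

Lemma subgroup_preimage (H : set G) : is_subgroup H ->
  is_subgroup (@sgval G S @^-1` H).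
Proof.
move=> Hg; apply: is_subgroupP => [|x y Hx Hy]; first exact: (subgroup1 Hg).
exact: (subgroupM Hg Hx (subgroupV Hg Hy)).
Qed.

Lemma subgroup_incl A : is_subgroup A -> is_subgroup (incl A).
Proof.
move=> Ag; apply: is_subgroupP => [|_ _ [x Ax <-] [y Ay <-]].
  by exists 1 => //; exact: subgroup1.
exists (x * y^-1) => //; apply: subgroupM => //; exact: subgroupV.
Qed.

Lemma family_cap_subgroup A : FS A -> is_subgroup A.
Proof.
move=> [H FH <-]; apply: subgroup_preimage.
exact: family_subgroup F_family _ FH.
Qed.

Lemma family_cap_incl A : FS A -> F (incl A).
Proof.
move=> FA; have [H FH AE] := FA; apply: (family_sub F_family FH).
  by apply: subgroup_incl; exact: family_cap_subgroup.
by rewrite -AE => _ [a Ha <-].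
Qed.

Definition orbit_incl_ob (d : ob (orbit_category FS)) : ob (orbit_category F) :=
  exist F (incl (sval d)) (family_cap_incl (svalP d)).

Section OnMorphisms.
Variables (d e : ob (orbit_category FS)) (f : hom d e).

Let dS := family_cap_subgroup (svalP d).

Lemma orbit_incl_coset : exists g, incl (gimg f) = ltrans g (incl (sval e)).
Proof.
have [u ->] := gimg_coset f; exists (sgval u); exact: incl_ltrans.
Qed.

Lemma orbit_incl_stable h : incl (sval d) h ->
  ltrans h (incl (gimg f)) `<=` incl (gimg f).
Proof. by move=> [a da <-]; rewrite -incl_ltrans (gimg_stable f dS da). Qed.

Definition orbit_incl_mor : hom (orbit_incl_ob d) (orbit_incl_ob e) :=
  mk_gmap (subgroup_incl dS) orbit_incl_coset orbit_incl_stable.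

Lemma gimg_orbit_incl_mor : gimg orbit_incl_mor = incl (gimg f).
Proof. exact: gimg_mk_gmap. Qed.

End OnMorphisms.

Lemma orbit_subgroup (x : ob (orbit_category F)) : is_subgroup (sval x).
Proof. exact: family_subgroup F_family _ (svalP x). Qed.

(** The functor [S/H |-> G/H] between orbit categories. *)
Definition orbit_incl : functor (orbit_category FS) (orbit_category F).
Proof.
refine (@Functor (orbit_category FS) (orbit_category F)
  orbit_incl_ob orbit_incl_mor _ _).
- move=> d; apply: gimg_inj; first exact: orbit_subgroup.
  by rewrite gimg_orbit_incl_mor.
- move=> d e e' g f; apply: gimg_inj; first exact: orbit_subgroup.
  rewrite gimg_orbit_incl_mor gimg_comp; last exact: family_cap_subgroup (svalP e).
  rewrite gimg_comp; last exact: (orbit_subgroup (orbit_incl_ob e)).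
  by rewrite !gimg_orbit_incl_mor incl_mul.
Defined.

Section Multiadjoint.
Variable L : ob (orbit_category F).

(** The fixed points of [L] on [G/S], each represented by the chosen element of
the coset: [g S] is fixed if and only if [L ^ g] is contained in [S]. *)
Definition fixed_coset (g : G) :=
  coset_rep S g = g /\ forall l, sval L l -> l ^ g \in S.

Variable g : {g : G | fixed_coset g}.

Definition conj_set : set G := [set h ^ sval g | h in sval L].

(** The orbit [S/(L ^ g)]. *)
Definition fixed_ob : ob (orbit_category FS) :=
  exist _ (@sgval G S @^-1` conj_set)
    (ex_intro2 F _ conj_set (family_conj F_family (sval g) (svalP L)) erefl).

Lemma incl_fixed_ob : incl (sval fixed_ob) = conj_set.
Proof.
by apply: incl_preimage => _ [l Ll <-]; case: (svalP g) => _; exact.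
Qed.

Lemma fixed_unit_coset : exists b,
  set_mul (sval L) [set sval g] = ltrans b (incl (sval fixed_ob)).
Proof.
exists (sval g); rewrite incl_fixed_ob eqEsubset; split.
- move=> _ [l Ll [_ -> <-]]; exists (l ^ sval g); first by exists l.
  by rewrite conjgE mulVKg.
- move=> _ [_ [l Ll <-] <-]; exists l => //; exists (sval g) => //.
  by rewrite conjgE mulVKg.
Qed.

Lemma fixed_unit_stable l : sval L l ->
  ltrans l (set_mul (sval L) [set sval g]) `<=` set_mul (sval L) [set sval g].
Proof.
by move=> Ll; rewrite -set_mul_ltrans (ltrans_subgroup (orbit_subgroup L) Ll).
Qed.

(** The isomorphism from [G/L] to [G/(L ^ g)] that sends [L] to the coset
[L g = g (L ^ g)]. *)
Definition fixed_unit : hom L (orbit_incl fixed_ob) :=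
  mk_gmap (orbit_subgroup L) fixed_unit_coset fixed_unit_stable.

Lemma gimg_fixed_unit : gimg fixed_unit = set_mul (sval L) [set sval g].
Proof. exact: gimg_mk_gmap (orbit_subgroup L) _ _. Qed.

End Multiadjoint.

(** The factorization of a [G]-map [f : G/L -> G/H], where [H] is a subgroup of
[S]. If [f] sends [L] to the coset [b H], the fixed point is [b S]; with [g] its
representative, the [S]-map sends [L ^ g] to [g^-1 b H]. *)
Section Factor.
Variables (L : ob (orbit_category F)) (d : ob (orbit_category FS)).
Variable f : hom L (orbit_incl d).

Let dG := orbit_subgroup (orbit_incl d).
Let LG := orbit_subgroup L.

Lemma exists_gimg : exists b, gimg f b.
Proof. exact: gimg_mem dG. Qed.

(* [b] is an arbitrary element of the coset; [g] does not depend on it. *)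
Let b := sval (cid exists_gimg).
Let fb : gimg f b := svalP (cid exists_gimg).
Let g := coset_rep S b.

Lemma gimg_conj l x : sval L l -> gimg f x -> l ^ x \in S.
Proof.
move=> Ll fx; have : gimg f (l * x).
  by rewrite -(gimg_stable f LG Ll); exists x.
rewrite (gimgE dG fx) => -[h dh hE].
by rewrite conjgE -hE mulKg; exact: incl_sub dh.
Qed.

Lemma factor_fixed : fixed_coset L g.
Proof.
split; first exact: coset_rep_rep.
move=> l Ll; have gb : b^-1 * g \in S by rewrite -gpredV invgM invgK coset_repP.
rewrite -[g](mulVKg b) conjgM gpredJ //.
exact: gimg_conj.
Qed.

Definition factor_ix : {g | fixed_coset L g} := exist _ g factor_fixed.

Let B := @sgval G S @^-1` ltrans g^-1 (gimg f).

Lemma incl_factor : incl B = ltrans g^-1 (gimg f).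
Proof.
apply: incl_preimage => _ [x fx <-].
move: fx; rewrite (gimgE dG fb) => -[h dh <-].
by rewrite mulgA gpredMr ?coset_repP //; exact: incl_sub dh.
Qed.

Lemma factor_coset : exists u, B = ltrans u (sval d).
Proof.
exists (SubgroupElt (coset_repP S b)); apply: incl_inj.
by rewrite incl_factor incl_ltrans (gimgE dG fb) ltransM.
Qed.

Lemma factor_stable h : sval (fixed_ob factor_ix) h -> ltrans h B `<=` B.
Proof.
move=> [l Ll lh] _ [x [y fy xE] <-]; exists (l * y).
  by rewrite -(gimg_stable f LG Ll); exists y.
rewrite -[RHS]/(sgval h * sgval x) -lh -xE conjgE /= -/g.
by rewrite -!mulgA mulVKg.
Qed.

Definition factor_mor : hom (fixed_ob factor_ix) d :=
  mk_gmap (family_cap_subgroup (svalP (fixed_ob factor_ix)))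
    factor_coset factor_stable.

Lemma gimg_factor_mor : gimg factor_mor = B.
Proof.
exact: gimg_mk_gmap (family_cap_subgroup (svalP (fixed_ob factor_ix))) _ _.
Qed.

Definition orbit_factor :
    {i : {g | fixed_coset L g} & hom (fixed_ob i) d} :=
  existT _ factor_ix factor_mor.

Lemma orbit_factorK :
  compmor (fmor orbit_incl factor_mor) (fixed_unit factor_ix) = f.
Proof.
apply: gimg_inj LG _; rewrite gimg_comp; last exact: orbit_subgroup.
rewrite gimg_fixed_unit gimg_orbit_incl_mor gimg_factor_mor incl_factor.
rewrite -[RHS](gimg_mul f LG) -set_mulA; congr set_mul.
rewrite eqEsubset; split=> [_ [_ -> [_ [y fy <-] <-]]|y fy] /=.
  by rewrite mulVKg.
exists g => //; exists (g^-1 * y); first by exists y.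
by rewrite mulVKg.
Qed.

Lemma factor_ixE x : gimg f x -> sval (projT1 orbit_factor) = coset_rep S x.
Proof.
move=> fx; apply: coset_rep_eq; move: fx.
rewrite (gimgE dG fb) => -[h dh <-]; rewrite mulKg; exact: incl_sub dh.
Qed.

Lemma gimg_factorE :
  gimg (projT2 orbit_factor) =
  @sgval G S @^-1` ltrans (sval (projT1 orbit_factor))^-1 (gimg f).
Proof. exact: gimg_factor_mor. Qed.

End Factor.

Lemma factorization_eq (L : ob (orbit_category F)) (d : ob (orbit_category FS))
    (p q : {i : {g | fixed_coset L g} & hom (fixed_ob i) d}) :
  sval (projT1 p) = sval (projT1 q) ->
  gimg (projT2 p) = gimg (projT2 q) -> p = q.
Proof.
case: p q => -[g gL] u [[g' g'L] v] /= gg'.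
case: g' / gg' g'L v => g'L v.
rewrite -(Prop_irrelevance gL g'L) in v * => uv.
congr existT; apply: gimg_inj uv.
exact: family_cap_subgroup (svalP (fixed_ob (exist _ g gL))).
Qed.

Lemma orbit_factor_uniq (L : ob (orbit_category F)) (d : ob (orbit_category FS))
    (i : {g | fixed_coset L g}) (u : hom (fixed_ob i) d) :
  orbit_factor (compmor (fmor orbit_incl u) (fixed_unit i)) = existT _ i u.
Proof.
have LG := orbit_subgroup L.
have iS := family_cap_subgroup (svalP (fixed_ob i)).
set f := compmor _ _.
have fE : gimg f = ltrans (sval i) (incl (gimg u)).
  rewrite gimg_comp; last exact: orbit_subgroup.
  rewrite gimg_fixed_unit gimg_orbit_incl_mor -[in RHS](gimg_mul u iS).
  rewrite incl_mul incl_fixed_ob eqEsubset; split.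
  - move=> _ [_ [l Ll [_ -> <-]] [y uy <-]]; exists (l ^ sval i * y).
      by exists (l ^ sval i); [exists l | exists y].
    by rewrite conjgE -!mulgA mulVKg.
  - move=> _ [_ [_ [l Ll <-] [y uy <-]] <-]; exists (l * sval i).
      by exists l => //; exists (sval i).
    by exists y => //; rewrite conjgE -!mulgA mulVKg.
have iE : sval (projT1 (orbit_factor f)) = sval i.
  have [c uc] := gimg_mem u (family_cap_subgroup (svalP d)).
  rewrite (@factor_ixE L d f (sval i * sgval c)); last first.
    by rewrite fE; exists (sgval c) => //; exists c.
  rewrite -[RHS](proj1 (svalP i)); apply: esym.
  by apply: coset_rep_eq; rewrite mulKg; exact: sgvalP.
apply: factorization_eq => //.
rewrite gimg_factorE iE fE ltransM mulVg ltrans1.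
by apply: incl_inj; rewrite incl_preimage // => x; exact: incl_sub.
Qed.

(** A [G]-map [G/L -> G/H] with [H] in [S] determines a point of [G/S] fixed by
[L]; the maps over a fixed point [g S] are the [S]-maps from
[S / (L ^ g)]. *)
Definition orbit_multiadjoint : multiadjoint orbit_incl :=
  @Multiadjoint _ _ orbit_incl (fun L => {g | fixed_coset L g})
    (@fixed_ob) (@fixed_unit) (@orbit_factor) (@orbit_factorK)
    (@orbit_factor_uniq).

End OrbitInclusion.

(** * The telescope of an increasing sequence of subgroups *)

Section GroupTelescope.
Variables (G : groupType) (F : set (set G)).
Hypothesis F_family : is_family F.
Variable S : nat -> groupClosed G.
Hypothesis S_incr : forall k, {subset S k <= S k.+1}.
Hypothesis S_union : forall g, exists k, g \in S k.
Hypothesis F_sub : forall H, F H -> exists k, forall h, H h -> h \in S k.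

Lemma S_le m n : (m <= n)%N -> {subset S m <= S n}.
Proof.
move=> /subnK <-; elim: (n - m)%N => [//|k IHk] g gm.
by rewrite addSn; apply/S_incr/IHk.
Qed.

Lemma fixed_coset_rep k (L : ob (orbit_category F)) g :
  (forall l, sval L l -> l ^ g \in S k) ->
  fixed_coset (S k) L (coset_rep (S k) g).
Proof.
move=> Lg; split=> [|l Ll]; first exact: coset_rep_rep.
have gr : g^-1 * coset_rep (S k) g \in S k.
  by rewrite -gpredV invgM invgK coset_repP.
by rewrite -[coset_rep _ _](mulVKg g) conjgM gpredJ // Lg.
Qed.

(** The projection [G/S_k -> G/S_(k + 1)] on the points fixed by [L]. *)
Definition orbit_step k (L : ob (orbit_category F))
    (g : {g | fixed_coset (S k) L g}) : {g | fixed_coset (S k.+1) L g} :=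
  exist _ (coset_rep (S k.+1) (sval g))
    (fixed_coset_rep (fun l Ll => S_incr ((svalP g).2 l Ll))).

Lemma fixed_eq k (L : ob (orbit_category F)) (g g' : {g | fixed_coset (S k) L g}) :
  sval g = sval g' -> g = g'.
Proof. by case: g g' => g gL [g' g'L] /=; exact: eq_exist. Qed.

Local Notation A := (fun k => orbit_multiadjoint F_family (S k)).

Lemma orbit_step_nat k (L L' : ob (orbit_category F)) (a : hom L' L)
    (g : adj_ix (A k) L) :
  @orbit_step k L' (projT1 (factor (A k) (compmor (adj_unit g) a))) =
  projT1 (factor (A k.+1)
    (compmor (adj_unit (@orbit_step k L g : adj_ix (A k.+1) L)) a)).
Proof.
have LG := orbit_subgroup F_family L.
have [x ax] := gimg_mem a LG.
have mem k' (g' : adj_ix (A k') L) : gimg (compmor (adj_unit g') a) (x * sval g').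
  rewrite gimg_comp // gimg_fixed_unit; exists x => //.
  exists (sval g'); last by [].
  by exists 1; [exact: subgroup1 | exists (sval g'); rewrite // mul1g].
apply: fixed_eq.
apply: etrans (congr1 (coset_rep (S k.+1)) (factor_ixE (mem k g))) _.
apply: etrans _ (esym (factor_ixE (mem k.+1 (orbit_step g)))).
rewrite coset_rep_rep //=.
by apply: coset_rep_eq; rewrite invgM -mulgA mulKg -gpredV invgM invgK coset_repP.
Qed.

(** After [n] steps, a point at level [k] becomes its image at level [n + k]. *)
Lemma iter_orbit_step (L : ob (orbit_category F)) n
    (j : {k : nat & adj_ix (A k) L}) :
  let j' := iter n (total_step (A := A) (@orbit_step) (L := L)) j in
  projT1 j' = (n + projT1 j)%N /\
  sval (projT2 j') = coset_rep (S (n + projT1 j)) (sval (projT2 j)).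
Proof.
elim: n => [|n [IH1 IH2]] /=.
  by split=> //; case: (svalP (projT2 j)).
split; first by rewrite IH1.
rewrite IH2 IH1 coset_rep_rep //; exact: S_incr.
Qed.

Lemma index_eq (L : ob (orbit_category F)) (j j' : {k : nat & adj_ix (A k) L}) :
  projT1 j = projT1 j' -> sval (projT2 j) = sval (projT2 j') -> j = j'.
Proof.
case: j j' => k g [k' g'] /= kk'; case: k' / kk' g' => g' gg'.
by rewrite (fixed_eq gg').
Qed.

(** The points [g S_i] and [g0 S_j] have the same image in [G/S_m] as soon as
[g^-1 g0] lies in [S_m]. *)
Lemma orbit_step_confluent (L : ob (orbit_category F))
    (j j0 : {k : nat & adj_ix (A k) L}) :
  exists m n, iter m (total_step (A := A) (@orbit_step) (L := L)) j =
              iter n (total_step (A := A) (@orbit_step) (L := L)) j0.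
Proof.
have [k jk] := S_union ((sval (projT2 j))^-1 * sval (projT2 j0)).
exists (k + projT1 j0)%N, (k + projT1 j)%N.
have [m1 m2] := iter_orbit_step (k + projT1 j0) j.
have [n1 n2] := iter_orbit_step (k + projT1 j) j0.
have mn : (k + projT1 j0 + projT1 j = k + projT1 j + projT1 j0)%N by rewrite addnAC.
apply: index_eq; first by rewrite m1 n1.
rewrite m2 n2 mn; apply: coset_rep_eq; apply: S_le jk.
by rewrite -addnA leq_addr.
Qed.

Lemma exists_fixed_coset (L : ob (orbit_category F)) :
  exists j : {k : nat & adj_ix (A k) L}, True.
Proof.
have [k Lk] := F_sub (svalP L).
have L1 l : sval L l -> l ^ 1 \in S k by rewrite conjg1; exact: Lk.
by exists (existT (fun k => adj_ix (A k) L) k (exist _ _ (fixed_coset_rep L1))).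
Qed.

Lemma proj_resolution_chain n :
  (forall k, proj_resolution_of_length
     (constZ (orbit_category (family_cap F (S k)))) n) ->
  proj_resolution_of_length (constZ (orbit_category F)) n.+1.
Proof.
apply: (telescope_resolution (A := A) (step := @orbit_step)).
- exact: orbit_step_nat.
- exact: exists_fixed_coset.
- exact: orbit_step_confluent.
Qed.

End GroupTelescope.

(** A countable directed family of subgroups has a cofinal increasing
sequence. *)
Lemma cofinal_chain (G : groupType) (I : Type) (G_ : I -> groupClosed G) :
  countable [set: I] -> I ->
  (forall i j, exists k, {subset G_ i <= G_ k} /\ {subset G_ j <= G_ k}) ->
  exists c : nat -> I, (forall k, {subset G_ (c k) <= G_ (c k.+1)}) /\
    (forall i, exists k, {subset G_ i <= G_ (c k)}).
Proof.
move=> /countable_injP[f f_inj] i0 G_dir.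
have [e eP] : exists e : nat -> I, forall i, e (f i) = i.
  (* [e] is a left inverse of the injection [f], with value [i0] off its range *)
  have /dep_choice[e eP] n : exists i, forall i', f i' = n -> i = i'.
    case: (pselect (exists i, f i = n)) => [[i <-]|ni].
      by exists i => i' ii'; apply: f_inj; rewrite ?inE.
    by exists i0 => i' fi'; case: ni; exists i'.
  by exists e => i; exact: eP.
have /dep_choice[ub ubP] : forall p : I * I, exists k,
    {subset G_ p.1 <= G_ k} /\ {subset G_ p.2 <= G_ k}.
  by move=> p; exact: G_dir.
pose c := fix c n := if n is n'.+1 then ub (c n', e n') else i0.
exists c; split=> [k|i]; first by have [] := ubP (c k, e k).
exists (f i).+1; have [_] := ubP (c (f i), e (f i)).
by rewrite /= [in G_ (e _)]eP.
Qed.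

(** * Projective dimension *)

Local Close Scope group_scope.
Local Open Scope ring_scope.

Section ProjectiveDimension.
Variables (R : realType) (C : category) (M : rmodule C).

Lemma proj_resolution_le m n : (m <= n)%N ->
  proj_resolution_of_length M m -> proj_resolution_of_length M n.
Proof.
move=> mn [P [d [eps [Pproj e_epi ex0 ex P0]]]].
by exists P, d, eps; split=> // k nk; apply: P0; exact: leq_ltn_trans mn nk.
Qed.

Lemma projdim_le n : proj_resolution_of_length M n -> (projdim R M <= n%:R%:E)%E.
Proof. by move=> Mn; apply: ereal_inf_lbound; exists n. Qed.

Lemma projdim_ge0 : (0 <= projdim R M)%E.
Proof. by apply: le_ereal_inf_tmp => _ [n _ <-]; rewrite lee_fin. Qed.

(** Since resolutions of length [m] are of every length [n >= m], a module
without a resolution of length [n] has projective dimension at least [n + 1]. *)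
Lemma projdim_gt n : ~ proj_resolution_of_length M n -> (n.+1%:R%:E <= projdim R M)%E.
Proof.
move=> Mn; apply: le_ereal_inf_tmp => _ [m Mm <-].
rewrite lee_fin ler_nat ltnNge; apply/negP => mn; apply: Mn.
exact: proj_resolution_le Mm.
Qed.

End ProjectiveDimension.

Lemma ereal_nat_unbounded (R : realType) (x : \bar R) :
  (forall n : nat, (n%:R%:E <= x)%E) -> x = +oo%E.
Proof.
move=> nx; apply: eq_infty => r; apply: le_trans (nx (Num.trunc r).+1).
by rewrite lee_fin ltW // truncnS_gt.
Qed.

Theorem corollary4p3 (R : realType) (G : groupType)
  (I : Type) (G_ : I -> groupClosed G) (F : set (set G))
  (I_countable : countable [set: I])
  (G_directed : forall i j : I, exists k : I,
    {subset G_ i <= G_ k} /\ {subset G_ j <= G_ k})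
  (G_union : forall g : G, exists i : I, g \in G_ i)
  (F_family : is_family F)
  (F_sub : forall H : set G, F H -> exists j : I, H `<=` [set` G_ j]) :
  (cd R F <= 1 + ereal_sup [set cd R (family_cap F (G_ i)) | i in [set: I]])%E.
Proof.
have [i0 _] := G_union 1%g.
have [c [c_incr c_cofinal]] := cofinal_chain I_countable i0 G_directed.
pose bounded n := forall i, proj_resolution_of_length
  (constZ (orbit_category (family_cap F (G_ i)))) n.
set s := ereal_sup _.
have s_ge i : (cd R (family_cap F (G_ i)) <= s)%E.
  by apply: ereal_sup_ubound; exists i.
have cd_le n : bounded n -> (cd R F <= n.+1%:R%:E)%E.
  move=> resn; apply: projdim_le.
  apply: (proj_resolution_chain F_family c_incr) => [g|H /F_sub[j Hj]|k].
  - have [i gi] := G_union g; have [k ik] := c_cofinal i.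
    by exists k; exact: ik.
  - by have [k jk] := c_cofinal j; exists k => h /Hj; exact: jk.
  - exact: resn.
have s_gt n : ~ bounded n -> (n.+1%:R%:E <= s)%E.
  move=> /existsNP[i resi]; apply: le_trans (s_ge i).
  exact: projdim_gt.
have s_ge0 : (0 <= s)%E by apply: le_trans (s_ge i0); exact: projdim_ge0.
have [[n resn]|unbounded] := pselect (exists n, bounded n).
  (* the least bound m is at most s: for m > 0, m - 1 is not a bound *)
  have [m /asboolP resm m_min] := @ex_minnP (fun m => `[< bounded m >])
    (ex_intro _ n (asboolT resn)).
  apply: le_trans (cd_le m resm) _.
  rewrite -natr1 addrC EFinD leeD2l //.
  case: m resm m_min => [//|m] _ m_min; apply: s_gt => /asboolP /m_min.
  by rewrite ltnn.
rewrite (_ : s = +oo%E) ?addey ?leey //.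
apply: ereal_nat_unbounded => n; apply: le_trans (s_gt n _).
  by rewrite lee_fin ler_nat.
by move=> resn; apply: unbounded; exists n.
Qed.
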